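(* Let $0<p<1$. Let $\mu$ be the Lebesgue measure on $\mathbb{R}^n$, let $\Omega\subset\mathbb{R}^n$ be $\mu$-measurable, and let $(E,\|\cdot\|)$ be a nonzero Banach space. There does not exist a $\mu$-measurable function $u:\Omega\to\mathbb{R}$, independent of $f$, such that $$\left\|\int_\Omega f\,d\mu\right\|^p\le\int_\Omega u\,\|f\|^p\,d\mu$$ holds for all $f\in L^1(\Omega\to E)$.
   Context: $L^1(\Omega\to E)$ denotes the Banach space of strongly (Bochner) measurable functions $f:\Omega\to E$ that are Bochner integrable, and $\int_\Omega f\,d\mu$ is the Bochner integral.
   Formalization: The formal theorem assumes that Ω has positive Lebesgue measure and that n ≥ 1; if Ω is a null set both sides vanish for every f, so u = 0 works and the claim as worded fails, and for n = 0 the function u = 1 works. *)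

(* Defs.v *)
From HB Require Import structures.
From mathcomp Require Import all_boot all_order all_algebra.
From mathcomp Require Import all_classical all_reals all_analysis.
Set Implicit Arguments.
Unset Strict Implicit.
Unset Printing Implicit Defensive.
Import Order.TTheory GRing.Theory Num.Theory.
Import numFieldNormedType.Exports.
Local Open Scope classical_set_scope.
Local Open Scope ring_scope.

Section lebesgue_outer.
Context {R : realType} {n : nat}.
Implicit Types (a b : 'rV[R]_n) (A : set 'rV[R]_n).

Definition box a b : set 'rV[R]_n :=
  [set x | forall i, a ord0 i < x ord0 i <= b ord0 i].

Definition box_volume a b : R := \prod_(i < n) Num.max 0 (b ord0 i - a ord0 i).

(* A cover is a possibly empty countable set of boxes, so the empty set has
   outer measure 0 also for n = 0, where no box is empty. *)
Definition box_cover A : set (set ('rV[R]_n * 'rV[R]_n)) :=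
  [set D | countable D /\ A `<=` \bigcup_(ab in D) box ab.1 ab.2].

Definition lebesgue_outer A : \bar R :=
  ereal_inf [set \esum_(ab in D) (box_volume ab.1 ab.2)%:E | D in box_cover A].

Lemma box_volume_ge0 a b : 0 <= box_volume a b.
Proof. by apply: prodr_ge0 => i _; rewrite le_max lexx. Qed.

Local Open Scope ereal_scope.

Let vol_ge0 (ab : 'rV[R]_n * 'rV[R]_n) : 0 <= (box_volume ab.1 ab.2)%:E.
Proof. by rewrite lee_fin box_volume_ge0. Qed.

Let lebesgue_outer_ge0 A : 0 <= lebesgue_outer A.
Proof. by apply: le_ereal_inf_tmp => _ [D _ <-]; exact: esum_ge0. Qed.

Let lebesgue_outer0 : lebesgue_outer set0 = 0.
Proof.
apply/eqP; rewrite eq_le lebesgue_outer_ge0 andbT.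
apply: ereal_inf_lbound; exists set0; last by rewrite esum_set0.
by split; [exact: countable0|exact: sub0set].
Qed.

Let le_lebesgue_outer : {homo lebesgue_outer : A B / A `<=` B >-> A <= B}.
Proof.
move=> A B AB; apply/ereal_inf_le_tmp => _ [D [cD BD] <-].
by exists D => //; split => //; exact: subset_trans AB BD.
Qed.

Let lebesgue_outer_sigma_subadditive : sigma_subadditive lebesgue_outer.
Proof.
move=> F; have [[i Fioo]|] := pselect (exists i, lebesgue_outer (F i) = +oo).
  rewrite (eseries_pinfty _ _ Fioo) ?leey// => k _.
  by rewrite -ltNye (lt_le_trans _ (lebesgue_outer_ge0 _)).
rewrite -forallNE => Foo.
apply/lee_addgt0Pr => e e0.
rewrite (le_trans _ (epsilon_trick _ _ (ltW e0)))//.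
pose P k D := box_cover (F k) D /\
  \esum_(ab in D) (box_volume ab.1 ab.2)%:E <=
    lebesgue_outer (F k) + (e / (2 ^ k.+1)%:R)%:E.
have [D PD] : {D & forall k, P k (D k)}.
  apply: (@choice _ _ P) => k.
  have Ffin : lebesgue_outer (F k) \is a fin_num.
    by rewrite ge0_fin_numE// lt_neqAle leey andbT; exact/eqP/Foo.
  have ek : (0 < e / (2 ^ k.+1)%:R)%R by rewrite divr_gt0// ltr0n expn_gt0.
  have [_ [Dk cDk <-] Dlt] := lb_ereal_inf_adherent ek Ffin.
  by exists Dk; split => //; exact: ltW.
have le1 : lebesgue_outer (\bigcup_k F k) <=
    \esum_(ab in \bigcup_k D k) (box_volume ab.1 ab.2)%:E.
  apply: ereal_inf_lbound; exists (\bigcup_k D k) => //; split.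
    by apply: bigcup_countable => // k _; exact: (PD k).1.1.
  move=> x [k _ /(PD k).1.2[ab Dab xab]].
  by exists ab => //; exists k.
apply: (le_trans le1); rewrite seqDU_bigcup_eq.
rewrite (esum_bigcupT _ _ (@trivIset_seqDU _ _) vol_ge0).
rewrite nneseries_esumT; last first.
  by move=> k; rewrite adde_ge0 // lee_fin divr_ge0// ltW.
apply: le_esum => k _; apply: le_trans (PD k).2.
apply: ereal_sup_le => _ [X [finX XD] <-].
by exists X => //; split => // ab /XD; exact: subset_seqDU.
Qed.

HB.instance Definition _ := isOuterMeasure.Build R 'rV[R]_n lebesgue_outer
  lebesgue_outer0 lebesgue_outer_ge0 le_lebesgue_outer
  lebesgue_outer_sigma_subadditive.

End lebesgue_outer.

(* R^n with the sigma-algebra of Lebesgue (not only Borel) measurable sets *)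
Definition lebesgue_space (R : realType) (n : nat) :=
  caratheodory_type (@lebesgue_outer R n).
HB.instance Definition _ R n := Measurable.on (lebesgue_space R n).

Definition lebesgue_measure_rV (R : realType) (n : nat) :
  set (lebesgue_space R n) -> \bar R := @lebesgue_outer R n.
HB.instance Definition _ R n :=
  isMeasure.Build _ (lebesgue_space R n) R (@lebesgue_measure_rV R n)
    (@caratheodory_measure0 _ _ (@lebesgue_outer R n))
    (@caratheodory_measure_ge0 _ _ (@lebesgue_outer R n))
    (@caratheodory_measure_sigma_additive _ _ (@lebesgue_outer R n)).

Section bochner.
Context {d : measure_display} {T : measurableType d} {R : realType}.
Context {E : normedModType R}.
Variable mu : {measure set T -> \bar R}.
Implicit Types (D : set T) (f s : T -> E).

Definition simple_function D s :=
  finite_set (s @` D) /\ forall y, measurable (D `&` s @^-1` [set y]).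

Definition strongly_measurable D f := exists g_ : nat -> T -> E,
  (forall k, simple_function D (g_ k)) /\
  {ae mu, forall x, D x -> g_ ^~ x @ \oo --> f x}.

Definition integrable_simple D s := simple_function D s /\
  forall y, y != 0 -> (mu (D `&` s @^-1` [set y]) < +oo)%E.

(* The value 0 may be taken on a set of infinite measure: its term is 0. *)
Definition simple_integral D s : E :=
  \sum_(y \in s @` D) fine (mu (D `&` s @^-1` [set y])) *: y.

Definition bochner_approx D f (g_ : nat -> T -> E) :=
  (forall k, integrable_simple D (g_ k)) /\
  (fun k => \int[mu]_(x in D) `|f x - g_ k x|%:E)%E @ \oo --> 0%E.

Definition bochner_integrable D f :=
  strongly_measurable D f /\ exists g_, bochner_approx D f g_.

(* For bochner_integrable f and complete E exactly one v satisfies this *)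
Definition bochner_integral D f : E :=
  get [set v | exists2 g_, bochner_approx D f g_ &
                 (fun k => simple_integral D (g_ k)) @ \oo --> v].

End bochner.

(* Main.v *)
(* For some M the set of x in Omega with u x <= M has positive measure. Cutting
   R^n into small half-open cubes yields a measurable subset B of it whose measure t
   is positive and as small as desired. Testing the inequality on the function
   equal to e on B and 0 elsewhere gives t^p <= M t, i.e. 1 <= M t^(1-p), which
   fails for small t. *)
Require Import Defs.
From mathcomp Require Import all_boot all_order all_algebra.
From mathcomp Require Import all_classical all_reals all_analysis measurable_realfun lra.
Import Order.TTheory GRing.Theory Num.Theory.
Import numFieldNormedType.Exports.
Local Open Scope classical_set_scope.
Local Open Scope ring_scope.

(** Here [e] may fail to be injective, since different boxes can have the same cut piece. A section
    [g] of [e] picks one preimage of each image point, which turns the left sum into a subsum of the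
    right one. *)
Lemma le_esum_image (R : realType) (I J : choiceType) (P : set I) (e : I -> J)
    (a : J -> \bar R) : (forall j, 0 <= a j)%E ->
  (\esum_(j in e @` P) a j <= \esum_(i in P) a (e i))%E.
Proof.
(* The point [i0] is the default value of [g] off the image. *)
move=> a0; have [->|/set0P[i0 _]] := eqVneq P set0.
  by rewrite image_set0 !esum_set0.
have /choice[g gP] : forall j, exists i, (e @` P) j -> P i /\ e i = j.
  move=> j; have [[i Pi <-]|nPj] := pselect ((e @` P) j); first by exists i.
  by exists i0.
have gI : set_inj (e @` P) g.
  by move=> j k /set_mem/gP[_ {2}<-] /set_mem/gP[_ {2}<-] ->.
rewrite (eq_esum (b := fun j => a (e (g j)))) => [|j /gP[_ ->]//].
rewrite -(esum_image _ _ (fun i => a (e i)) gI).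
apply: ereal_sup_le => _ [X [finX XgP] <-]; exists X => //.
by split => // i /XgP[j /gP[Pg _] <-].
Qed.

(** * Measurability of half-spaces and boxes *)

Section halfspace.
Context {R : realType} {n : nat}.
Implicit Types (a b x : 'rV[R]_n) (c : R).

Definition set_coord (i : 'I_n) c x : 'rV[R]_n :=
  \row_j if j == i then c else x ord0 j.

(** The pieces of a box on the two sides of a hyperplane. If the hyperplane misses the box, one
    piece has its ends equal or reversed in direction [i], and the truncation in [box_volume] gives
    it volume 0. *)
Definition box_below i c (ab : 'rV[R]_n * 'rV[R]_n) :=
  (ab.1, set_coord i (Num.min (ab.2 ord0 i) c) ab.2).

Definition box_above i c (ab : 'rV[R]_n * 'rV[R]_n) :=
  (set_coord i (Num.max (ab.1 ord0 i) c) ab.1, ab.2).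

Lemma box_volume_split i c ab :
  box_volume (box_below i c ab).1 (box_below i c ab).2 +
  box_volume (box_above i c ab).1 (box_above i c ab).2 =
  box_volume ab.1 ab.2.
Proof.
rewrite /box_volume [in RHS](bigD1 i)//=.
rewrite [X in X + _](bigD1 i)//= [X in _ + X](bigD1 i)//= !mxE eqxx.
under eq_bigr => j /negbTE ji do rewrite mxE ji.
under [X in _ + _ * X]eq_bigr => j /negbTE ji do rewrite mxE ji.
rewrite -mulrDl; congr (_ * _).
(* Only the factor [i] differs, so the claim is about lengths of intervals cut at [c]. *)
move: (ab.1 ord0 i) (ab.2 ord0 i) => s t.
rewrite /Num.max /Num.min; do !case: ifPn; lra.
Qed.

(** Cutting every box of a cover of [A] along the hyperplane yields covers of the two parts of [A]
    with no more total volume. This is the nontrivial inequality of Caratheodory's criterion. *)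
Lemma lebesgue_measurable_halfspace (i : 'I_n) c :
  measurable ([set x | x ord0 i <= c] : set (lebesgue_space R n)).
Proof.
apply: le_caratheodory_measurable => A.
apply: le_ereal_inf_tmp => _ [D [cD AD] <-].
under eq_esum => ab _ do rewrite -(box_volume_split i c) EFinD.
rewrite esumD => [|ab _|ab _]; rewrite ?lee_fin ?box_volume_ge0//.
have vol0 (ab : 'rV[R]_n * 'rV[R]_n) : (0 <= (box_volume ab.1 ab.2)%:E)%E.
  by rewrite lee_fin box_volume_ge0.
apply: leeD; (apply: le_trans; last exact: (le_esum_image _ _ _ _ _ _ vol0));
  apply: ereal_inf_lbound; eexists => //; split; try by apply: sub_countable cD; exact: card_image_le.
  move=> x [/AD[ab Dab xab] /= xc].
  exists (box_below i c ab); first by exists ab.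
  move=> j /=; rewrite mxE; case: eqP => [->|_]; last exact: xab.
  by rewrite le_min xc; have /andP[-> ->] := xab i.
move=> x [/AD[ab Dab xab] /= /negP xc].
exists (box_above i c ab); first by exists ab.
move=> j /=; rewrite mxE; case: eqP => [->|_]; last exact: xab.
by rewrite gt_max [c < _]ltNge xc; have /andP[-> ->] := xab i.
Qed.

Lemma lebesgue_measurable_box a b :
  measurable (box a b : set (lebesgue_space R n)).
Proof.
rewrite (_ : box a b = \bigcap_(i in [set: 'I_n])
   ([set x | x ord0 i <= b ord0 i] `\` [set x | x ord0 i <= a ord0 i])).
  apply: fin_bigcap_measurable => // i _.
  by apply: measurableD; exact: lebesgue_measurable_halfspace.
apply/seteqP; split => x xab i.
  by move=> _; have /andP[ai bi] := xab i; split => //; apply/negP; rewrite -ltNge.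
by have [//|/= -> /negP] := xab i; rewrite -ltNge => ->.
Qed.

Lemma lebesgue_measure_box_le a b :
  (@lebesgue_measure_rV R n (box a b) <= (box_volume a b)%:E)%E.
Proof.
apply: ereal_inf_lbound; exists [set (a, b)].
  by split; [exact: countable1|rewrite bigcup_set1].
by rewrite esum_set1// lee_fin box_volume_ge0.
Qed.
End halfspace.

(** By contraposition: a countable union of null sets is null. The indices are coded by naturals,
    with the empty set at codes of no index. *)
Lemma measure_bigcup_gt0 d (T : measurableType d) (R : realType)
    (mu : {measure set T -> \bar R}) (I : countType) (F : I -> set T) :
  (forall i, measurable (F i)) -> (0 < mu (\bigcup_i F i))%E ->
  exists i, (0 < mu (F i))%E.
Proof.
move=> mF; apply: contraPP => /forallNP F0.
have mu0 i : mu (F i) = 0%E.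
  by apply/eqP; rewrite eq_le measure_ge0 andbT leNgt; exact/negP.
suff : mu.-negligible (\bigcup_i F i).
  by move=> /negligibleP ->; rewrite ?ltxx//; apply: countable_bigcupT_measurable.
pose G k := if unpickle k is Some i then F i else set0.
apply: (@negligibleS _ _ _ _ (\bigcup_k G k)).
  by move=> x [i _ Fix]; exists (pickle i) => //; rewrite /G pickleK.
apply: negligible_bigcup => k; rewrite /G.
case: unpickle => [i|]; last exact: negligible_set0.
by apply/negligibleP; [exact: mF|exact: mu0].
Qed.

(** * Small subsets of positive measure *)

Section small_sets.
Context {R : realType} {n : nat}.
Local Notation mu := (@lebesgue_measure_rV R n).

Lemma exists_small_subset (A : set (lebesgue_space R n)) (r : R) :
  (0 < n)%N -> 0 < r <= 1 -> measurable A -> (0 < mu A)%E ->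
  exists B, [/\ measurable B, B `<=` A, (0 < mu B)%E & (mu B <= r%:E)%E].
Proof.
move=> n0 /andP[r0 r1] mA A0.
pose cube (k : 'rV[int]_n) : set (lebesgue_space R n) :=
  box (\row_i (r * (k ord0 i - 1)%:~R)) (\row_i (r * (k ord0 i)%:~R)).
have mcube k : measurable (cube k) by exact: lebesgue_measurable_box.
have cover : \bigcup_k (A `&` cube k) = A.
  apply/seteqP; split => [x [k _ []]//|x Ax].
  (* The half-open cubes match the ceiling: [ceil y - 1 < y <= ceil y]. *)
  exists (\row_i Num.ceil (r^-1 * (x : 'rV_n) ord0 i)) => //; split => // i.
  rewrite !mxE -ltr_pdivlMl// -ler_pdivrMl//; exact: ceil_itv.
have [k Bk] : exists k, (0 < mu (A `&` cube k))%E.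
  apply: measure_bigcup_gt0; last by rewrite cover.
  by move=> k; exact: measurableI.
exists (A `&` cube k); split => //; first exact: measurableI.
apply: (@le_trans _ _ (mu (cube k))); first exact: measureIr.
apply: le_trans (lebesgue_measure_box_le _ _) _.
rewrite lee_fin /box_volume.
under eq_bigr => i _.
  rewrite !mxE -mulrBr -intrB opprB addrC subrK mulr1 max_r ?ltW//; over.
(* The cube has volume [r ^ n], which is at most [r] because [r <= 1] and [0 < n]. *)
rewrite prodr_const card_ord; case: n n0 => // m _.
by rewrite exprS -[leRHS]mulr1 ler_wpM2l ?exprn_ile1 ?(ltW r0).
Qed.
End small_sets.

(** The function [f] may change sign and need not be integrable: dropping its negative part only
    increases the integral, and [g] dominates the positive part. *)
Lemma le_integral_ge0 d (T : measurableType d) (R : realType)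
    (mu : {measure set T -> \bar R}) (D : set T) (f g : T -> \bar R) :
  measurable D -> measurable_fun D f -> measurable_fun D g ->
  (forall x, D x -> 0 <= g x)%E -> (forall x, D x -> f x <= g x)%E ->
  (\int[mu]_(x in D) f x <= \int[mu]_(x in D) g x)%E.
Proof.
move=> mD mf mg g0 fg; rewrite integralE.
apply: (@le_trans _ _ (\int[mu]_(x in D) f^\+ x)%E).
  by apply: geeDl; rewrite oppe_le0; exact: integral_ge0.
apply: ge0_le_integral => // [|x Dx]; first exact: measurable_funepos.
by rewrite funeposE ge_max fg ?g0.
Qed.

(** * The Bochner integral of a scaled indicator *)

Section bochner_indicator.
Context {d : measure_display} {T : measurableType d} {R : realType}.
Context {E : normedModType R}.
Variables (mu : {measure set T -> \bar R}) (D B : set T) (e : E).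
Hypotheses (mD : measurable D) (mB : measurable B) (BD : B `<=` D).
Hypothesis Boo : (mu B < +oo)%E.

Definition indic_scale (x : T) : E := (\1_B x : R) *: e.

Lemma indic_scaleE x : indic_scale x = if x \in B then e else 0.
Proof.
by rewrite /indic_scale indicE; case: (x \in B); rewrite ?scale1r ?scale0r.
Qed.

Lemma integrable_simple_indic_scale : integrable_simple mu D indic_scale.
Proof.
have mpre y : measurable (D `&` indic_scale @^-1` [set y]).
  (* The union of two conditional sets also covers [e = 0], where both conditions hold for
     [y = 0]. *)
  rewrite (_ : indic_scale @^-1` [set y] =
    (if e == y then B else set0) `|` (if 0 == y then ~` B else set0)).
    by apply: measurableI => //; apply: measurableU; case: ifP => // _;
      exact: measurableC.
  apply/seteqP; split => x /=; rewrite indic_scaleE.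
    case: ifPn => [/set_mem Bx|/negP nBx] ->; rewrite eqxx; first by left.
    by right => Bx; apply: nBx; exact: mem_set.
  case=> [|]; case: eqP => [<-|_]//= Bx; first by rewrite mem_set.
  by rewrite memNset.
split; [split => //|move=> y y0].
  apply: (@sub_finite_set _ _ [set e; 0]); last exact: finite_set2.
  by move=> _ [x _ <-]; rewrite indic_scaleE /=; case: ifP; [left|right].
apply: le_lt_trans Boo; apply: le_measure; rewrite ?inE// => x [_ /=].
by rewrite indic_scaleE; case: ifP => [/set_mem|_ y00]//; rewrite y00 eqxx in y0.
Qed.

Lemma bochner_approx_indic_scale :
  bochner_approx mu D indic_scale (fun=> indic_scale).
Proof.
split => [_|]; first exact: integrable_simple_indic_scale.
under eq_fun => k do under eq_integral do rewrite subrr normr0.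
by rewrite integral0; exact: cvg_cst.
Qed.

Lemma bochner_integrable_indic_scale : bochner_integrable mu D indic_scale.
Proof.
split; exists (fun=> indic_scale); last exact: bochner_approx_indic_scale.
split => [_|]; first exact: integrable_simple_indic_scale.1.
by apply: aeW => x _; exact: cvg_cst.
Qed.

(* Both sides are computed on the atoms [s = y] intersected with [B] and its
   complement, where [s] and the scaled indicator are constant. *)
Lemma simple_integral_indic_dist (s : T -> E) : integrable_simple mu D s ->
  (`|fine (mu B) *: e - simple_integral mu D s|%:E <=
   \int[mu]_(x in D) `|indic_scale x - s x|%:E)%E.
Proof.
move=> [[fins ms] soo].
set Y := finmap.enum_fset (fset_set (s @` D)).
pose C y := D `&` s @^-1` [set y].
pose h y x := `|e - y| * \1_(C y `&` B) x + `|y| * \1_(C y `\` B) x.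
have mC y : measurable (C y) by exact: ms.
have mCB y : measurable (C y `&` B) by exact: measurableI.
have mCD y : measurable (C y `\` B) by exact: measurableD.
have memY x : D x -> s x \in Y.
  by move=> Dx; apply: etrans (in_fset_set fins _) (mem_set _); exists x.
have hE x : D x -> `|indic_scale x - s x| = \sum_(y <- Y) h y x.
  move=> Dx; rewrite (bigD1_seq (s x))//= ?memY ?finmap.fset_uniq// big1 ?addr0; last first.
    move=> y /eqP ysx; rewrite /h !indicE !memNset ?mulr0 ?addr0//.
      by move=> [[_ /esym]].
    by move=> [[_ /esym]].
  rewrite indic_scaleE /h !indicE; have [Bx|nBx] := boolP (x \in B).
    rewrite [x \in _ `&` _]mem_set ?mulr1; last by split => //; exact: set_mem.
    by rewrite memNset ?mulr0 ?addr0// => -[_]; apply; exact: set_mem.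
  have nBx' : ~ B x by move/mem_set; exact/negP.
  rewrite sub0r normrN [x \in _ `&` _]memNset ?mulr0 ?add0r; last by case.
  by rewrite mem_set ?mulr1.
have CBoo y : (mu (C y `&` B) < +oo)%E.
  by apply: le_lt_trans Boo; apply: le_measure; rewrite ?inE// => x [].
(* For [y = 0] this measure may be infinite; below, that case is always treated apart, its term
   being 0. *)
have CDoo y : y != 0 -> (mu (C y `\` B) < +oo)%E.
  move=> y0; apply: le_lt_trans (soo _ y0).
  by apply: le_measure; rewrite ?inE// => x [].
have muB : fine (mu B) = \sum_(y <- Y) fine (mu (C y `&` B)).
  have {1}-> : B = \big[setU/set0]_(y <- Y) (C y `&` B).
    rewrite bigsetU_fset_set//; apply/seteqP; split => [x Bx|x [y _ []]//].
    by exists (s x); [exists x => //; exact: BD|split => //; split => //; exact: BD].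
  rewrite measure_fbigsetU//; last first.
    by move=> y z _ _ [x [[[_ /= <-] _] [[_ /= <-] _]]].
  by rewrite -sum_fine// => y _; rewrite ge0_fin_numE ?CBoo.
have simpleE : simple_integral mu D s =
    \sum_(y <- Y) (fine (mu (C y `&` B)) *: y + fine (mu (C y `\` B)) *: y).
  rewrite /simple_integral fsbig_finite//; apply: eq_bigr => y _.
  have [->|y0] := eqVneq y 0; first by rewrite !scaler0 addr0.
  rewrite -scalerDl -fineD ?ge0_fin_numE// ?CDoo//.
  by rewrite addeC -measureDI.
(* The atom of [y] contributes [e - y] weighted by its part in [B], minus [y] weighted by the rest;
   the triangle inequality then gives the sum that the integral evaluates to. *)
rewrite muB simpleE scaler_suml -sumrB.
apply: (@le_trans _ _ (\sum_(y <- Y)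
    (fine (mu (C y `&` B)) * `|e - y| + fine (mu (C y `\` B)) * `|y|)%:E)%E).
  rewrite sumEFin lee_fin; apply: le_trans (ler_norm_sum _ _ _) _.
  apply: ler_sum => y _; rewrite opprD addrA -scalerBr.
  by apply: le_trans (ler_normB _ _) _; rewrite !normrZ !ger0_norm ?fine_ge0.
rewrite (eq_integral (fun x => \sum_(y <- Y) (h y x)%:E)%E); last first.
  by move=> x /set_mem Dx; rewrite sumEFin hE.
rewrite ge0_integral_sum//.
- apply: lee_sum => y _; rewrite /h.
  under eq_integral do rewrite EFinD.
  have mI c (A : set T) : measurable A ->
      measurable_fun D ((fun x => c * \1_A x : R) : T -> R).
    by move=> mA; apply: measurable_funM.
  rewrite ge0_integralD//; try (by move=> x _; rewrite lee_fin mulr_ge0);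
    try by apply/measurable_EFinP; exact: mI.
  under eq_integral do rewrite EFinM.
  under [X in (_ <= _ + X)%E]eq_integral do rewrite EFinM.
  rewrite !ge0_integralZl_EFin//; try by move=> x _; rewrite lee_fin.
  + rewrite !integral_indic//.
    rewrite ![_ `&` D]setIidl; try by move=> x [[]].
    rewrite EFinD; apply: leeD; rewrite EFinM muleC.
      by rewrite fineK// ge0_fin_numE ?CBoo.
    have [->|y0] := eqVneq y 0; first by rewrite normr0 !mul0e.
    by rewrite fineK// ge0_fin_numE ?CDoo.
  + by apply/measurable_EFinP.
  + by apply/measurable_EFinP.
- move=> y; apply/measurable_EFinP; apply: measurable_funD;
    exact: measurable_funM.
- by move=> y x _; rewrite lee_fin addr_ge0// mulr_ge0.
Qed.

(** The distance bound forces the integrals of every approximating sequence to converge to this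
    value. The constant sequence shows that [get] chooses from a nonempty set, and uniqueness of
    limits identifies the choice. *)
Lemma bochner_integral_indic_scale :
  bochner_integral mu D indic_scale = fine (mu B) *: e.
Proof.
have lim_eq g : bochner_approx mu D indic_scale g ->
    (fun k => simple_integral mu D (g k)) @ \oo --> fine (mu B) *: e.
  move=> [ig cg]; apply/cvgrPdist_le => r r0.
  have : \forall k \near \oo,
      (\int[mu]_(x in D) `|indic_scale x - g k x|%:E < r%:E)%E.
    by apply: (cg _ (open_ereal_lt' _)); rewrite lte_fin.
  apply: filterS => k /ltW; rewrite -lee_fin; apply: le_trans.
  exact: simple_integral_indic_dist.
rewrite /bochner_integral; set S := [set v | _].
have [g ag gv] : S (get S).
  apply: getPex; exists (fine (mu B) *: e), (fun=> indic_scale).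
    exact: bochner_approx_indic_scale.
  exact: lim_eq bochner_approx_indic_scale.
exact: norm_cvg_unique gv (lim_eq _ ag).
Qed.
(** An upper bound of [u] on [B] suffices because the integrand vanishes off [B]: [0 < p] makes the
    power of 0 equal to 0. No lower bound of [u] enters, hence the comparison by
    [le_integral_ge0]. *)
Lemma integral_powR_indic_scale_le (u : T -> R) (p M : R) :
  measurable_fun D u -> 0 < p -> 0 < M -> (forall x, B x -> u x <= M) ->
  (\int[mu]_(x in D) (u x * `|indic_scale x| `^ p)%:E <=
   (M * `|e| `^ p * fine (mu B))%:E)%E.
Proof.
move=> mfu p0 M0 uM.
have normE x : `|indic_scale x| `^ p = `|e| `^ p * \1_B x.
  rewrite indic_scaleE indicE; case: (x \in B); rewrite ?mulr1//.
  by rewrite normr0 powR0 ?mulr0// gt_eqF.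
under eq_integral do rewrite normE.
have c0 : 0 <= M * `|e| `^ p by rewrite mulr_ge0 ?powR_ge0// ltW.
apply: (@le_trans _ _ (\int[mu]_(x in D)
    ((M * `|e| `^ p)%:E * (\1_B x)%:E))%E).
  apply: le_integral_ge0 => //.
  - by apply/measurable_EFinP; apply: measurable_funM => //; exact: measurable_funM.
  - by apply/measurable_EFinP; exact: measurable_funM.
  - by move=> x _; rewrite -EFinM lee_fin mulr_ge0.
  move=> x Dx; rewrite -EFinM lee_fin -mulrA indicE.
  have [Bx|_] := boolP (x \in B); last by rewrite !mulr0.
  by rewrite ler_wpM2r ?mulr_ge0 ?powR_ge0//; apply: uM; exact: set_mem.
rewrite ge0_integralZl_EFin//; try exact/measurable_EFinP.
by rewrite integral_indic// setIidl// [in leRHS]EFinM fineK// ge0_fin_numE.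
Qed.
End bochner_indicator.

Theorem theorem2p4 (R : realType) (n : nat) (p : R)
    (Omega : set (lebesgue_space R n)) (E : completeNormedModType R) :
  (0 < n)%N -> 0 < p < 1 ->
  measurable Omega -> (0 < lebesgue_measure_rV Omega)%E ->
  (exists e : E, e != 0) ->
  ~ exists u : lebesgue_space R n -> R,
      measurable_fun Omega u /\
      forall f : lebesgue_space R n -> E,
        bochner_integrable (@lebesgue_measure_rV R n) Omega f ->
        ((`|bochner_integral (@lebesgue_measure_rV R n) Omega f| `^ p)%:E <=
           \int[@lebesgue_measure_rV R n]_(x in Omega)
              (u x * `|f x| `^ p)%:E)%E.
Proof.
move=> n0 /andP[p0 p1] mO O0 [e e0] [u [mfu ineq]].
pose level (k : nat) := Omega `&` [set x | u x <= k.+1%:R].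
have mlevel k : measurable (level k).
  rewrite /level (_ : [set x | _] = u @^-1` `]-oo, k.+1%:R]); first exact: mfu.
  by apply/seteqP; split => x /=; rewrite in_itv.
have [k Ak] : exists k, (0 < lebesgue_measure_rV (level k))%E.
  apply: measure_bigcup_gt0 => //.
  rewrite (_ : \bigcup_k level k = Omega)//.
  apply/seteqP; split => [x [k _ []]//|x Ox].
  (* The bound [k.+1] in [level] absorbs the rounding down. *)
  exists (Num.truncn `|u x|) => //; split => //=.
  by rewrite (le_trans (ler_norm _))// ltW// truncnS_gt.
pose M : R := k.+1%:R.
have M1 : 1 <= M by rewrite /M ler1n.
have M0 : 0 < M by exact: lt_le_trans M1.
have uM x : level k x -> u x <= M by case.
clearbody M.
pose r := (2 * M)^-1 `^ (1 - p)^-1.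
have q0 : 0 < 1 - p by rewrite subr_gt0.
have iM : 0 < (2 * M)^-1 < 1.
  by rewrite invr_gt0 mulr_gt0//= invf_lt1 ?mulr_gt0//; lra.
have r01 : 0 < r <= 1.
  have /andP[? ?] := iM.
  (* A base in [(0, 1)] has decreasing powers, so the exponent is compared with 0. *)
  rewrite powR_gt0//= -[leRHS](powRr0 (2 * M)^-1).
  by apply: ger_powR; [apply/andP; split=> //; exact: ltW|rewrite invr_ge0 ltW].
have [B [mB BA B0 Br]] := exists_small_subset _ _ n0 r01 (mlevel k) Ak.
have BO : B `<=` Omega by move=> x /BA[].
have Boo : (lebesgue_measure_rV B < +oo)%E by exact: le_lt_trans Br (ltry _).
pose t := fine (lebesgue_measure_rV B).
have tE : lebesgue_measure_rV B = t%:E by rewrite fineK// ge0_fin_numE.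
have t0 : 0 < t by rewrite -lte_fin -tE.
have tr : t <= r by rewrite -lee_fin -tE.
have ep0 : 0 < `|e| `^ p by rewrite powR_gt0 ?normr_gt0.
have := ineq _ (bochner_integrable_indic_scale _ _ _ e mO mB Boo).
rewrite bochner_integral_indic_scale// -/t normrZ gtr0_norm// powRM//;
  last exact: ltW.
apply/negP; rewrite -ltNge.
apply: le_lt_trans
  (integral_powR_indic_scale_le _ _ _ e mO mB BO Boo _ _ _ mfu p0 M0 _) _.
  by move=> x Bx; apply/uM/BA.
rewrite lte_fin -/t mulrAC ltr_pM2r//.
have tq : t `^ (1 - p) <= (2 * M)^-1.
  have /andP[i0 i1] := iM.
  have <- : r `^ (1 - p) = (2 * M)^-1.
    by rewrite -powRrM mulVf ?lt0r_neq0// powRr1// ltW.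
  by apply: ge0_ler_powR; rewrite ?nnegrE ?powR_ge0// ltW.
have {1}-> : t = t `^ p * t `^ (1 - p).
  by rewrite -powRD ?subrKC ?powRr1// ?ltW// (gt_eqF t0) implybT.
have tp0 : 0 < t `^ p by exact: powR_gt0.
rewrite mulrCA -[ltRHS]mulr1 ltr_pM2l//.
apply: (@le_lt_trans _ _ (M * (2 * M)^-1)); first by rewrite ler_pM2l.
rewrite invfM mulrCA divff ?gt_eqF// mulr1 invf_lt1//; lra.
Qed.
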